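(* Let $\mathfrak p=(p_1,p_2,p_3,p_4)$ be a quadruple of distinct points in the Heisenberg group $\mathfrak H$, and let $d_K$ be the Korányi–Cygan metric. Then $$d_K(p_2,p_3)\,d_K(p_1,p_4)\le d_K(p_2,p_4)\,d_K(p_1,p_3)+d_K(p_1,p_2)\,d_K(p_3,p_4),$$ $$d_K(p_1,p_3)\,d_K(p_2,p_4)\le d_K(p_1,p_2)\,d_K(p_3,p_4)+d_K(p_2,p_3)\,d_K(p_1,p_4),$$ $$d_K(p_1,p_2)\,d_K(p_3,p_4)\le d_K(p_1,p_3)\,d_K(p_2,p_4)+d_K(p_2,p_3)\,d_K(p_1,p_4).$$ Moreover: (1) $d_K(p_2,p_3)d_K(p_1,p_4)=d_K(p_2,p_4)d_K(p_1,p_3)+d_K(p_1,p_2)d_K(p_3,p_4)$ if and only if all four points lie on an $\mathbb R$-circle and $p_1$ and $p_4$ separate $p_2$ and $p_3$; (2) $d_K(p_1,p_3)d_K(p_2,p_4)=d_K(p_1,p_2)d_K(p_3,p_4)+d_K(p_2,p_3)d_K(p_1,p_4)$ if and only if all four points lie on an $\mathbb R$-circle and $p_1$ and $p_3$ separate $p_2$ and $p_4$; (3) $d_K(p_1,p_2)d_K(p_3,p_4)=d_K(p_1,p_3)d_K(p_2,p_4)+d_K(p_2,p_3)d_K(p_1,p_4)$ if and only if all four points lie on an $\mathbb R$-circle and $p_1$ and $p_2$ separate $p_3$ and $p_4$.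
   Context: The Heisenberg group $\mathfrak H$ is $\mathbb C\times\mathbb R$ with group law $(z,t)*(w,s)=(z+w,\,t+s+2\,\mathrm{Im}(\overline{w}z))$. The Korányi gauge is $|(z,t)|=\big||z|^2-it\big|^{1/2}$ and the Korányi–Cygan metric is $d_K(p,q)=|p^{-1}*q|$. Let $\mathbb C^{2,1}$ be $\mathbb C^3$ with Hermitian form $\langle\mathbf z,\mathbf w\rangle=z_1\overline{w_3}+z_2\overline{w_2}+z_3\overline{w_1}$, $V_0=\{\mathbf z\neq0:\langle\mathbf z,\mathbf z\rangle=0\}$, $V_-=\{\mathbf z:\langle\mathbf z,\mathbf z\rangle<0\}$, $\mathbb P$ the projectivization to $\mathbb CP^2$, $\mathbf H^2_{\mathbb C}=\mathbb P(V_-)$ and $\partial\mathbf H^2_{\mathbb C}=\mathbb P(V_0)$. The map $(z,t)\mapsto\mathbb P\big([-|z|^2+it,\ \sqrt2 z,\ 1]^T\big)$ identifies $\mathfrak H$ with $\partial\mathbf H^2_{\mathbb C}$ minus the point $\infty=\mathbb P([1,0,0]^T)$. An $\mathbb R$-circle in $\partial\mathbf H^2_{\mathbb C}$ is the boundary of a Lagrangian plane (an isometric image of $\mathbf H^2_{\mathbb R}$ in $\mathbf H^2_{\mathbb C}$), equivalently an image under $\mathrm{PU}(2,1)$ (the projectivized group of linear maps preserving $\langle\cdot,\cdot\rangle$) of $\mathbb P(V_0\cap\mathbb R^3)$; ''the points lie on an $\mathbb R$-circle'' means their images in $\partial\mathbf H^2_{\mathbb C}$ do (the $\mathbb R$-circle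 may pass through $\infty$). An $\mathbb R$-circle is a topological circle; ''$p_a$ and $p_b$ separate $p_c$ and $p_d$'' means $p_c,p_d$ lie in different components of the circle (including $\infty$ if it lies on it) with $p_a,p_b$ removed. *)

(* Defs.v *)
From mathcomp Require Import all_boot all_algebra.
From mathcomp Require Import all_classical all_reals all_analysis.
From mathcomp Require Import complex.
Set Implicit Arguments. Unset Strict Implicit. Unset Printing Implicit Defensive.
Import GRing.Theory Num.Theory numFieldNormedType.Exports.
Local Open Scope ring_scope.
Local Open Scope classical_set_scope.
Local Open Scope complex_scope.

Section Heisenberg.
Variable R : realType.

Definition cabs (z : R[i]) : R := ComplexField.Normc.normc z.

Definition heis := (R[i] * R)%type.

Definition hmul (p q : heis) : heis :=
  (p.1 + q.1, p.2 + q.2 + 2 * complex.Im (conjc q.1 * p.1)).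

Definition hinv (p : heis) : heis := (- p.1, - p.2).

Definition koranyi (p : heis) : R :=
  Num.sqrt (cabs (Complex ((cabs p.1) ^+ 2) (- p.2))).

Definition dK (p q : heis) : R := koranyi (hmul (hinv p) q).

Definition herm (v w : 'cV[R[i]]_3) : R[i] :=
  \sum_(k < 3) v k 0 * conjc (w (rev_ord k) 0).

Definition preserves_herm (A : 'M[R[i]]_3) : Prop :=
  forall v w : 'cV[R[i]]_3, herm (A *m v) (A *m w) = herm v w.

Definition proj_eq (u v : 'cV[R[i]]_3) : Prop :=
  exists2 lam : R[i], lam != 0 & u = lam *: v.

Definition vec3 (a b c : R[i]) : 'cV[R[i]]_3 :=
  \col_(k < 3) nth 0 [:: a; b; c] k.

Definition hlift (p : heis) : 'cV[R[i]]_3 :=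
  vec3 (Complex (- (cabs p.1) ^+ 2) p.2) ((Num.sqrt (2 : R))%:C * p.1) 1.

Definition cplxv (r : 'cV[R]_3) : 'cV[R[i]]_3 := map_mx (fun x : R => x%:C) r.

Definition on_Rcircle (A : 'M[R[i]]_3) (p : heis) : Prop :=
  exists r : 'cV[R]_3, [/\ r != 0, herm (cplxv r) (cplxv r) = 0 &
                           proj_eq (hlift p) (A *m cplxv r)].

Definition S1 : set (R * R) := [set w | w.1 ^+ 2 + w.2 ^+ 2 = 1].

(* homeomorphism S^1 -> P(V_0 \cap R^3), w |-> P([-(1-w1), sqrt2 w2, 1+w1]^T)
   (the "angle-halving" parametrization [cos(th/2) : sin(th/2)] of the conic) *)
Definition stdR (w : R * R) : 'cV[R]_3 :=
  \col_(k < 3) nth 0 [:: - (1 - w.1); Num.sqrt 2 * w.2; 1 + w.1] k.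

(* On the R-circle C = P(A(V_0 \cap R^3)), parametrized homeomorphically by
   S^1 via w |-> P(A stdR w), the points pa, pb separate pc and pd:
   pc and pd lie in different connected components of C minus {pa, pb}. *)
Definition separates (A : 'M[R[i]]_3) (pa pb pc pd : heis) : Prop :=
  exists wa wb wc wd : R * R,
    [/\ [/\ S1 wa, S1 wb, S1 wc & S1 wd],
        [/\ proj_eq (hlift pa) (A *m cplxv (stdR wa)),
            proj_eq (hlift pb) (A *m cplxv (stdR wb)),
            proj_eq (hlift pc) (A *m cplxv (stdR wc)) &
            proj_eq (hlift pd) (A *m cplxv (stdR wd))],
        (S1 `\` [set wa; wb]) wc, (S1 `\` [set wa; wb]) wd &
        ~ connected_component (S1 `\` [set wa; wb]) wc wd].

Definition Rcircle_sep (p1 p2 p3 p4 pa pb pc pd : heis) : Prop :=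
  exists A : 'M[R[i]]_3,
    [/\ preserves_herm A,
        [/\ on_Rcircle A p1, on_Rcircle A p2, on_Rcircle A p3 & on_Rcircle A p4]
      & separates A pa pb pc pd].

End Heisenberg.

(* Main.v *)
Require Import Defs.
From mathcomp Require Import all_boot all_order all_algebra.
From mathcomp Require Import all_classical all_reals all_analysis.
From mathcomp Require Import complex ring lra.
Import Order.TTheory GRing.Theory Num.Theory numFieldNormedType.Exports.
Set Implicit Arguments. Unset Strict Implicit. Unset Printing Implicit Defensive.
Local Open Scope ring_scope.
Local Open Scope classical_set_scope.

(** The standard lifts satisfy [|<p, q>| = dK p q ^+ 2], where [<p, q>] is the Hermitian product.
The 4x4 Gram determinant of four null vectors of C^3 vanishes; expanded, this reads
[a^2 + b^2 + c^2 = 2 Re (P1 + P2 + P3)], with [a], [b], [c] the squares of the three products of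
distances and [P1], [P2], [P3] the cyclic products of four Gram entries, of moduli [ac], [bc],
[ab].  Hence [a^2 + b^2 + c^2 <= 2 (ab + bc + ca)], which by Heron's factorization is Ptolemy's
inequality.  Equality forces every [Pi] to be positive; then all triple products
[<p,q><q,r><r,p>] are real, the lifts can be rescaled so that their Gram matrix is real, and the
points lie on an R-circle.  Conversely, in the angle-halving parametrization of an R-circle [dK]
is, up to a positive factor attached to each point, the absolute value of a 2x2 determinant, so
that Ptolemy's equality is the Pluecker relation with the signs dictated by separation. *)

(** * Points of the circle through half angles *)

Definition det2 (R : realType) (x y : R * R) : R := x.1 * y.2 - x.2 * y.1.

(** Sends (sin t, cos t) to (cos 2t, sin 2t). Dividing by the squared norm makes it constant on
    punctured lines through the origin, so it applies to nonzero vectors of any length. *)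
Definition double_angle (R : realType) (x : R * R) : R * R :=
  let n := x.1 ^+ 2 + x.2 ^+ 2 in ((x.2 ^+ 2 - x.1 ^+ 2) / n, 2 * x.1 * x.2 / n).

Lemma double_angleE (R : realType) (x : R * R) : S1 x ->
  double_angle x = (x.2 ^+ 2 - x.1 ^+ 2, 2 * x.1 * x.2).
Proof. by rewrite /S1 /= /double_angle => ->; rewrite !divr1. Qed.

Lemma sqrsum_neq0 (R : realType) (x : R * R) : x != 0 -> x.1 ^+ 2 + x.2 ^+ 2 != 0.
Proof.
case: x => a b; apply: contraNneq => /= /eqP.
by rewrite paddr_eq0 ?sqr_ge0// !sqrf_eq0 => /andP[/eqP-> /eqP->].
Qed.

Lemma double_angle_S1 (R : realType) (x : R * R) : x != 0 -> S1 (double_angle x).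
Proof. by move=> /sqrsum_neq0 x0; rewrite /S1 /double_angle /=; field. Qed.

Lemma half_angle (R : realType) (w : R * R) : S1 w ->
  exists2 x, S1 x & w = double_angle x.
Proof.
case: w => a b; rewrite /S1 /= => ab.
have a1 : 0 <= (1 + a) / 2 by nra.
have a2 : 0 <= (1 - a) / 2 by nra.
have e1 := sqr_sqrtr a1; have e2 := sqr_sqrtr a2.
(* The sine of the half angle. The cosine is taken nonnegative, so the sine has to carry the sign of
   [b]. *)
pose x := Num.sqrt ((1 - a) / 2) * (if b < 0 then -1 else 1).
have ex : x ^+ 2 = (1 - a) / 2.
  by rewrite /x; case: ifP => _; rewrite ?mulrN1 ?mulr1 ?sqrrN.
have Sx : S1 (x, Num.sqrt ((1 + a) / 2)) by rewrite /S1/= ex e1; field.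
exists (x, Num.sqrt ((1 + a) / 2)) => //.
rewrite double_angleE//= e1 ex; congr pair; first by field.
have : b ^+ 2 = (2 * x * Num.sqrt ((1 + a) / 2)) ^+ 2.
  by rewrite exprMn (exprMn 2 2 x) ex e1; move: ab; nra.
move/eqP; rewrite eqf_sqr => /orP[/eqP//|/eqP e].
have s1 := sqrtr_ge0 ((1 + a) / 2); have s2 := sqrtr_ge0 ((1 - a) / 2).
move: e; rewrite /x; case: ltP => b0 e; nra.
Qed.

Lemma double_angle_eq (R : realType) (x y : R * R) : x != 0 -> y != 0 ->
  det2 x y = 0 <-> double_angle x = double_angle y.
Proof.
move=> /sqrsum_neq0 x0 /sqrsum_neq0 y0.
(* The squared chord between the two images: for unit vectors, [det2 x y] is the sine of the
   difference of the half angles. *)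
have key : ((double_angle x).1 - (double_angle y).1) ^+ 2
    + ((double_angle x).2 - (double_angle y).2) ^+ 2 =
  4 * det2 x y ^+ 2 / ((x.1 ^+ 2 + x.2 ^+ 2) * (y.1 ^+ 2 + y.2 ^+ 2)).
  by rewrite /double_angle /det2 /=; field; rewrite x0 y0.
split=> [d0|e].
  have /eqP := key; rewrite d0 expr0n/= mulr0 mul0r paddr_eq0 ?sqr_ge0// !sqrf_eq0 !subr_eq0.
  by move=> /andP[/eqP e1 /eqP e2]; exact: injective_projections.
have /eqP := key; rewrite e !subrr expr0n/= addr0 eq_sym !mulf_eq0
  invr_eq0 mulf_eq0 (negbTE x0) (negbTE y0).
by rewrite !orbF pnatr_eq0/= orbb => /eqP.
Qed.

(* Affine in [double_angle x]: the side of the chord through the images of [a] and [b]. *)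
Lemma chord_side (R : realType) (a b x : R * R) : x != 0 ->
  let w := double_angle x in
  (x.1 ^+ 2 + x.2 ^+ 2)^-1 * (det2 a x * det2 b x) =
  (a.1 * b.1 + a.2 * b.2) / 2 + (a.1 * b.1 - a.2 * b.2) / 2 * w.1
  - (a.1 * b.2 + a.2 * b.1) / 2 * w.2.
Proof. by move=> /sqrsum_neq0 x0; rewrite /double_angle /det2 /=; field. Qed.

(** * Separation on the circle as a sign of determinants *)

Lemma S1_neq0 (R : realType) (x : R * R) : S1 x -> x != 0.
Proof. by apply: contraPneq => ->; rewrite /S1/= expr0n addr0 => /eqP; rewrite eq_sym oner_eq0. Qed.

(** On the circle the affine function [L] of the chord equals [det2 a x * det2 b x], so it vanishes
    only at the images of [a] and [b]. It has opposite signs at the images of [c] and [d], so by the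
    intermediate value theorem a connected set joining them would contain a zero of [L]. *)
Lemma opposite_sides_separate (R : realType) (a b c d : R * R) :
  S1 a -> S1 b -> S1 c -> S1 d ->
  det2 a c * det2 b c * (det2 a d * det2 b d) < 0 ->
  ~ connected_component (@S1 R `\` [set double_angle a; double_angle b])
      (double_angle c) (double_angle d).
Proof.
move=> Sa Sb Sc Sd lt0 [K [Kc KS conK] Kd].
pose L (w : R * R) := (a.1 * b.1 + a.2 * b.2) / 2 + (a.1 * b.1 - a.2 * b.2) / 2 * w.1
  - (a.1 * b.2 + a.2 * b.1) / 2 * w.2.
have LE x : S1 x -> L (double_angle x) = det2 a x * det2 b x.
  by move=> Sx; rewrite /L -chord_side ?S1_neq0// (Sx : _ = 1) invr1 mul1r.
have Lcont : continuous L.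
  move=> w; apply: cvgB; last by apply: cvgM; [exact: cvg_cst | exact: cvg_snd].
  by apply: cvgD; [exact: cvg_cst | apply: cvgM; [exact: cvg_cst | exact: cvg_fst]].
have /connected_intervalP Lint : connected (L @` K).
  by apply: connected_continuous_connected => //; exact: continuous_subspaceT.
have [w Kw Lw] : (L @` K) 0.
  have LKc : (L @` K) (L (double_angle c)) by exists (double_angle c).
  have LKd : (L @` K) (L (double_angle d)) by exists (double_angle d).
  move: lt0; rewrite -!LE// => lt0.
  have [Lc0|Lc0] := lerP (L (double_angle c)) 0.
    by apply: (Lint _ _ LKc LKd); rewrite Lc0 /=; nra.
  by apply: (Lint _ _ LKd LKc); rewrite (ltW Lc0) andbT; nra.
have [Sw nw] := KS _ Kw.
have [x Sx wx] := half_angle Sw.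
apply: nw; move: Lw; rewrite wx LE// => /eqP.
rewrite mulf_eq0 => /orP[]/eqP.
  by move/(double_angle_eq (S1_neq0 Sa) (S1_neq0 Sx)) ->; left.
by move/(double_angle_eq (S1_neq0 Sb) (S1_neq0 Sx)) ->; right.
Qed.

Lemma det2_eq0l (R : realType) (x : R * R) : det2 x 0 = 0.
Proof. by rewrite /det2 /= !mulr0 subrr. Qed.

Lemma double_angle_continuous (R : realType) (x : R * R) : x != 0 ->
  {for x, continuous (@double_angle R)}.
Proof.
move=> x0; have /= n0 := sqrsum_neq0 x0.
have c1 : (fun x : R * R => x.1) @ x --> x.1 by exact: cvg_fst.
have c2 : (fun x : R * R => x.2) @ x --> x.2 by exact: cvg_snd.
have cn : (fun x : R * R => (x.1 ^+ 2 + x.2 ^+ 2)^-1) @ x --> (x.1 ^+ 2 + x.2 ^+ 2)^-1.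
  by apply: cvgV => //; apply: cvgD; rewrite expr2; apply: cvgM.
apply: (@cvg_pair _ _ _ (nbhs x) (nbhs (double_angle x).1) (nbhs (double_angle x).2)
  _ _ _ (fun x => (double_angle x).1) (fun x => (double_angle x).2)).
  by apply: cvgM => //; apply: cvgB; rewrite expr2; apply: cvgM.
by apply: cvgM => //; apply: cvgM => //; apply: cvgM => //; exact: cvg_cst.
Qed.

(** As [d] and [- d] have the same image, [d] may be taken on the same side as [c] of the line of
    [a]; the hypothesis then gives the same for the line of [b]. The segment from [c] to [d]
    projects to an arc avoiding both images. *)
Lemma same_side_connected (R : realType) (a b c d : R * R) :
  S1 a -> S1 b -> S1 c -> S1 d ->
  0 < det2 a c * det2 b c * (det2 a d * det2 b d) ->
  connected_component (@S1 R `\` [set double_angle a; double_angle b])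
      (double_angle c) (double_angle d).
Proof.
move=> Sa Sb Sc Sd.
wlog acad : d Sd / 0 < det2 a c * det2 a d.
  move=> H gt0; have [ad|ad|ad] := ltrgtP 0 (det2 a c * det2 a d).
  - exact: H.
  - have -> : double_angle d = double_angle (- d).
      by rewrite /double_angle /= !sqrrN !mulrN !mulNr opprK.
    apply: H.
    + by rewrite /S1 /= !sqrrN.
    + by move: ad; rewrite /det2/=; nra.
    + by move: gt0; rewrite /det2/=; nra.
  - by move: gt0; rewrite mulrACA -ad mul0r ltxx.
rewrite mulrACA pmulr_rgt0// => bcbd.
(* The segment from [c] to [d] meets neither the line of [a] nor that of [b]. *)
pose g (u : R) : R * R := c + u *: (d - c).
have det2g e u : 0 < det2 e c * det2 e d -> 0 <= u <= 1 -> det2 e (g u) != 0.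
  move=> cd /andP[u0 u1].
  have -> : det2 e (g u) = (1 - u) * det2 e c + u * det2 e d.
    by rewrite /det2 /g /= /GRing.scale /=; ring.
  move: (det2 e c) (det2 e d) cd => X Y XY; apply/eqP => h.
  (* Multiplying by [X] turns the combination into one of two positive numbers with nonnegative
     weights, one of which is at least 1/2. *)
  have : (1 - u) * X ^+ 2 + u * (X * Y) = 0 by rewrite -(mulr0 X) -h; ring.
  have : 0 < X ^+ 2 by rewrite exprn_even_gt0//=; apply: contraTneq XY => ->; rewrite mul0r ltxx.
  move: (X ^+ 2) (X * Y) XY => P Q; have [u2|u2] := lerP u (1 / 2); nra.
have g0 u : 0 <= u <= 1 -> g u != 0.
  by move=> /(det2g _ _ acad); apply: contraNneq => ->; rewrite det2_eq0l.
exists ((@double_angle R \o g) @` `[0, 1]); last first.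
  by exists 1; rewrite /= ?in_itv/= ?ler01 ?lexx// /g scale1r addrC subrK.
split.
- by exists 0; rewrite /= ?in_itv/= ?ler01 ?lexx// /g scale0r addr0.
- move=> z [u /=]; rewrite in_itv/= => u01 <-; split.
    exact/double_angle_S1/g0.
  case=> /esym e.
    have /(double_angle_eq (S1_neq0 Sa) (g0 _ u01))/eqP := e.
    by apply/negP; exact: det2g.
  have /(double_angle_eq (S1_neq0 Sb) (g0 _ u01))/eqP := e.
  by apply/negP; exact: det2g.
- apply: connected_continuous_connected.
    by apply/connected_intervalP; exact: interval_is_interval.
  apply: continuous_in_subspaceT => u; rewrite inE /= in_itv/= => u01.
  apply: continuous_comp; last exact/double_angle_continuous/g0.
  by apply: cvgD; [exact: cvg_cst | apply: cvgZr_tmp; exact: cvg_id].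
Qed.

(** The Plücker relation writes the left side as |X - Y|, with X and Y the two products on the right
    before absolute values; |X - Y| = |X| + |Y| exactly when XY is nonpositive. *)
Lemma ptolemy_plane (R : realType) (a b c d : R * R) :
  `|det2 a b| * `|det2 c d| = `|det2 a c| * `|det2 b d| + `|det2 a d| * `|det2 b c| <->
  det2 a c * det2 b c * (det2 a d * det2 b d) <= 0.
Proof.
have plucker : det2 a b * det2 c d = det2 a c * det2 b d - det2 a d * det2 b c.
  by rewrite /det2; ring.
rewrite -!normrM plucker.
have -> : det2 a c * det2 b c * (det2 a d * det2 b d) =
  det2 a c * det2 b d * (det2 a d * det2 b c) by ring.
move: (det2 a c * det2 b d) (det2 a d * det2 b c) => X Y.
case: (ger0P X); case: (ger0P Y); case: (ger0P (X - Y)); move=> h1 h2 h3; split=> h; nra.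
Qed.

(** * Gram determinants *)

Local Open Scope complex_scope.

(** The entry gij pairs (ai, bi, 1) with (1, cj, dj), where [c] and [d] stand for conjugates, so the
    identity is polynomial. The 4x4 determinant vanishes, the vectors having three coordinates. The
    diagonal being zero, only derangements contribute: three double transpositions with sign +, six
    four-cycles with sign -. *)
Lemma gram4_identity (K : comPzRingType) (a1 a2 a3 a4 b1 b2 b3 b4 c1 c2 c3 c4 d1 d2 d3 d4 : K) :
  a1 + b1 * c1 + d1 = 0 -> a2 + b2 * c2 + d2 = 0 ->
  a3 + b3 * c3 + d3 = 0 -> a4 + b4 * c4 + d4 = 0 ->
  let g12 := a1 + b1 * c2 + d2 in let g21 := a2 + b2 * c1 + d1 in
  let g13 := a1 + b1 * c3 + d3 in let g31 := a3 + b3 * c1 + d1 in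
  let g14 := a1 + b1 * c4 + d4 in let g41 := a4 + b4 * c1 + d1 in
  let g23 := a2 + b2 * c3 + d3 in let g32 := a3 + b3 * c2 + d2 in
  let g24 := a2 + b2 * c4 + d4 in let g42 := a4 + b4 * c2 + d2 in
  let g34 := a3 + b3 * c4 + d4 in let g43 := a4 + b4 * c3 + d3 in
  g12 * g21 * (g34 * g43) + g13 * g31 * (g24 * g42) + g14 * g41 * (g23 * g32) =
  (g12 * g23 * g34 * g41 + g21 * g32 * g43 * g14)
  + (g13 * g32 * g24 * g41 + g31 * g23 * g42 * g14)
  + (g12 * g24 * g43 * g31 + g21 * g42 * g34 * g13).
Proof.
have e (a x d : K) : a + x + d = 0 -> a = - x - d by move=> h; rewrite -[- x]add0r -h; ring.
move=> /e -> /e -> /e -> /e -> /=; ring.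
Qed.

Lemma gram3_identity (K : comPzRingType) (a1 a2 a3 b1 b2 b3 c1 c2 c3 d1 d2 d3 : K) :
  a1 + b1 * c1 + d1 = 0 -> a2 + b2 * c2 + d2 = 0 -> a3 + b3 * c3 + d3 = 0 ->
  (a1 + b1 * c2 + d2) * (a2 + b2 * c3 + d3) * (a3 + b3 * c1 + d1) +
  (a2 + b2 * c1 + d1) * (a3 + b3 * c2 + d2) * (a1 + b1 * c3 + d3) =
  - ((a1 * (b2 - b3) + a2 * (b3 - b1) + a3 * (b1 - b2)) *
     (d1 * (c2 - c3) + d2 * (c3 - c1) + d3 * (c1 - c2))).
Proof.
have e (a x d : K) : a + x + d = 0 -> a = - x - d by move=> h; rewrite -[- x]add0r -h; ring.
move=> /e -> /e -> /e ->; ring.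
Qed.

(** * The Hermitian form and the standard lifts *)

Lemma conjcD (R : realType) (z w : R[i]) : conjc (z + w) = conjc z + conjc w.
Proof. exact: rmorphD. Qed.

Lemma conjcM (R : realType) (z w : R[i]) : conjc (z * w) = conjc z * conjc w.
Proof. exact: rmorphM. Qed.

Lemma conjcN (R : realType) (z : R[i]) : conjc (- z) = - conjc z.
Proof. exact: rmorphN. Qed.

Lemma herm_sum3 (R : realType) (v w : 'cV[R[i]]_3) : herm v w =
  v 0 0 * conjc (w (2%:R) 0) + v 1 0 * conjc (w 1 0) + v (2%:R) 0 * conjc (w 0 0).
Proof.
have -> : (2%:R : 'I_3) = lift ord0 (lift ord0 ord0) by exact/val_inj.
have -> : (1 : 'I_3) = lift ord0 ord0 by exact/val_inj.
rewrite /herm !big_ord_recl big_ord0 addr0 addrA.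
by do ![congr (_ + _)]; congr (_ * conjc (w _ _)); exact/val_inj.
Qed.

Lemma vec3_eta (R : realType) (v : 'cV[R[i]]_3) : v = vec3 (v 0 0) (v 1 0) (v (2%:R) 0).
Proof.
apply/matrixP => k j; rewrite !mxE (ord1 j).
by case: k => [[|[|[|//]]]] lt /=; congr (v _ _); exact/val_inj.
Qed.

Lemma hermZl (R : realType) (l : R[i]) (v w : 'cV[R[i]]_3) : herm (l *: v) w = l * herm v w.
Proof. by rewrite !herm_sum3 !mxE; ring. Qed.

Lemma hermZr (R : realType) (l : R[i]) (v w : 'cV[R[i]]_3) :
  herm v (l *: w) = conjc l * herm v w.
Proof. by rewrite !herm_sum3 !mxE !conjcM; ring. Qed.

Lemma hermDl (R : realType) (u v w : 'cV[R[i]]_3) : herm (u + v) w = herm u w + herm v w.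
Proof. by rewrite !herm_sum3 !mxE; ring. Qed.

Lemma hermDr (R : realType) (u v w : 'cV[R[i]]_3) : herm w (u + v) = herm w u + herm w v.
Proof. by rewrite !herm_sum3 !mxE !conjcD; ring. Qed.

Lemma conjc_herm (R : realType) (v w : 'cV[R[i]]_3) : conjc (herm v w) = herm w v.
Proof. by rewrite !herm_sum3 !conjcD !conjcM !conjcK; ring. Qed.

Lemma cplxvE (R : realType) (r : 'cV[R]_3) :
  cplxv r = vec3 (r 0 0)%:C (r 1 0)%:C (r (2%:R) 0)%:C.
Proof. by rewrite [LHS]vec3_eta !mxE. Qed.

Lemma herm_cplxv (R : realType) (r s : 'cV[R]_3) : herm (cplxv r) (cplxv s) =
  (r 0 0 * s (2%:R) 0 + r 1 0 * s 1 0 + r (2%:R) 0 * s 0 0)%:C.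
Proof. by rewrite herm_sum3 !mxE !conjc_real !rmorphD !rmorphM. Qed.

Definition frame (R : realType) (U0 U1 U2 : 'cV[R[i]]_3) : 'M[R[i]]_3 :=
  \matrix_(i < 3, j < 3) nth 0 [:: U0; U1; U2] j i 0.

Lemma frame_mul (R : realType) (U0 U1 U2 : 'cV[R[i]]_3) a b c :
  frame U0 U1 U2 *m vec3 a b c = a *: U0 + b *: U1 + c *: U2.
Proof.
apply/matrixP => k j; rewrite !mxE !big_ord_recl big_ord0 !mxE (ord1 j) /=.
by ring.
Qed.

(** The hypotheses say that the columns have the same Gram matrix as the standard basis. *)
Lemma frame_preserves_herm (R : realType) (U0 U1 U2 : 'cV[R[i]]_3) :
  herm U0 U0 = 0 -> herm U0 U1 = 0 -> herm U0 U2 = 1 ->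
  herm U1 U1 = 1 -> herm U1 U2 = 0 -> herm U2 U2 = 0 ->
  preserves_herm (frame U0 U1 U2).
Proof.
move=> h00 h01 h02 h11 h12 h22 v w.
rewrite [v in LHS]vec3_eta [w in LHS]vec3_eta !frame_mul.
rewrite !(hermDl, hermDr, hermZl, hermZr)
  -[herm U1 U0]conjc_herm -[herm U2 U0]conjc_herm -[herm U2 U1]conjc_herm.
by rewrite h00 h01 h02 h11 h12 h22 !rmorph0 rmorph1 herm_sum3; ring.
Qed.

(** For the form, the basis dual to [U0], [U1], [U2] is [U2], [U1], [U0]. Pairing with it gives a
    left inverse [B] of the frame, which is also a right inverse since the matrices are square. *)
Lemma frame_coord (R : realType) (U0 U1 U2 v : 'cV[R[i]]_3) :
  herm U0 U0 = 0 -> herm U0 U1 = 0 -> herm U0 U2 = 1 ->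
  herm U1 U1 = 1 -> herm U1 U2 = 0 -> herm U2 U2 = 0 ->
  frame U0 U1 U2 *m vec3 (herm v U2) (herm v U1) (herm v U0) = v.
Proof.
move=> h00 h01 h02 h11 h12 h22.
pose B : 'M[R[i]]_3 := \matrix_(i < 3, j < 3) conjc (nth 0 [:: U2; U1; U0] i (rev_ord j) 0).
have Bv u : B *m u = vec3 (herm u U2) (herm u U1) (herm u U0).
  apply/matrixP => k j; rewrite !mxE (ord1 j) /herm.
  transitivity (herm u (nth 0 [:: U2; U1; U0] k)).
    by rewrite /herm; apply: eq_bigr => i _; rewrite !mxE mulrC.
  by case: k => [[|[|[|//]]]] lt.
rewrite -Bv mulmxA (_ : _ *m B = 1%:M) ?mul1mx//; apply: mulmx1C.
apply/matrixP => k l; rewrite mxE.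
transitivity ((B *m nth 0 [:: U0; U1; U2] l) k 0).
  by rewrite mxE; apply: eq_bigr => i _; rewrite !mxE.
rewrite Bv !mxE; case: l => [[|[|[|//]]]] ll; case: k => [[|[|[|//]]]] lk //=;
  by rewrite -?[herm U1 U0]conjc_herm -?[herm U2 U0]conjc_herm -?[herm U2 U1]conjc_herm
    ?(h00, h01, h02, h11, h12, h22) ?rmorph0 ?rmorph1.
Qed.

Definition gram (R : realType) (p q : heis R) : R[i] := herm (hlift p) (hlift q).

Definition hlift0 (R : realType) (p : heis R) : R[i] := Complex (- cabs p.1 ^+ 2) p.2.
Definition hlift1 (R : realType) (p : heis R) : R[i] := (Num.sqrt 2 : R)%:C * p.1.

Lemma gramE (R : realType) (p q : heis R) :
  gram p q = hlift0 p + hlift1 p * conjc (hlift1 q) + conjc (hlift0 q).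
Proof.
rewrite /gram herm_sum3 !mxE /= (_ : Complex 1 (- 0) = 1) ?mulr1 ?mul1r//.
by rewrite oppr0.
Qed.

Lemma conjc_gram (R : realType) (p q : heis R) : conjc (gram p q) = gram q p.
Proof. exact: conjc_herm. Qed.

Lemma cabs_sqr (R : realType) (z : R[i]) : cabs z ^+ 2 = complex.Re z ^+ 2 + complex.Im z ^+ 2.
Proof. by case: z => a b; rewrite /cabs /= sqr_sqrtr// addr_ge0// sqr_ge0. Qed.

Lemma gram_dK (R : realType) (p q : heis R) : cabs (gram p q) = dK p q ^+ 2.
Proof.
rewrite /dK /koranyi sqr_sqrtr; last by rewrite /cabs /= sqrtr_ge0.
rewrite gramE /hlift0 /hlift1 !cabs_sqr; case: p => [[x y] t]; case: q => [[u v] s].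
rewrite /cabs /=; congr Num.sqrt.
have s2 : Num.sqrt 2 ^+ 2 = 2 :> R by rewrite sqr_sqrtr.
by congr (_ + _ ^+ 2); [rewrite -sqrrN; congr (_ ^+ 2)|]; ring: s2.
Qed.

Lemma gram_self (R : realType) (p : heis R) : gram p p = 0.
Proof.
rewrite gramE /hlift0 /hlift1 !cabs_sqr; case: p => [[x y] t].
have s2 : Num.sqrt 2 ^+ 2 = 2 :> R by rewrite sqr_sqrtr.
by apply/eqP; rewrite eq_complex /=; apply/andP; split; apply/eqP; ring: s2.
Qed.

Lemma cabsM (R : realType) (z w : R[i]) : cabs (z * w) = cabs z * cabs w.
Proof. exact: ComplexField.Normc.normcM. Qed.

Lemma cabsJ (R : realType) (z : R[i]) : cabs (conjc z) = cabs z.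
Proof. by case: z => a b; rewrite /cabs /= sqrrN. Qed.

Lemma Re_le_cabs (R : realType) (z : R[i]) : complex.Re z <= cabs z.
Proof.
case: z => a b; rewrite /cabs /=; apply: (le_trans (ler_norm _)).
by rewrite -sqrtr_sqr ler_sqrt ?addr_ge0 ?sqr_ge0// lerDl sqr_ge0.
Qed.

Lemma Re_eq_cabs (R : realType) (z : R[i]) : complex.Re z = cabs z -> z = (cabs z)%:C.
Proof.
move=> e; have := cabs_sqr z; rewrite -e; case: z e => a b /= _ /eqP.
by rewrite -subr_eq0 opprD addNKr oppr_eq0 sqrf_eq0 => /eqP ->.
Qed.

Lemma dKC (R : realType) (p q : heis R) : dK p q = dK q p.
Proof.
have h := gram_dK p q; rewrite -conjc_gram cabsJ gram_dK in h.
by apply/eqP; rewrite -(eqrXn2 (_ : 0 < 2)%N) ?sqrtr_ge0// h.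
Qed.

(** * The Ptolemaean inequality *)

Lemma realcD (R : realType) (x y : R) : (x + y)%:C = x%:C + y%:C.
Proof. exact: rmorphD. Qed.

Lemma realcM (R : realType) (x y : R) : (x * y)%:C = x%:C * y%:C.
Proof. exact: rmorphM. Qed.

Lemma realcN (R : realType) (x : R) : (- x)%:C = - x%:C.
Proof. exact: rmorphN. Qed.

Lemma mulcJ (R : realType) (z : R[i]) : z * conjc z = (cabs z ^+ 2)%:C.
Proof.
by rewrite cabs_sqr; case: z => a b; apply/eqP; rewrite eq_complex /=;
  apply/andP; split; apply/eqP; ring.
Qed.

Lemma dK_eq0 (R : realType) (p q : heis R) : dK p q = 0 -> p = q.
Proof.
rewrite /dK /koranyi; case: p => [[x y] t]; case: q => [[u v] s].
rewrite /cabs/= => /eqP; rewrite sqrtr_eq0 => h.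
have {h} : Num.sqrt ((Num.sqrt ((- x + u) ^+ 2 + (- y + v) ^+ 2) ^+ 2) ^+ 2 +
  (- (- t + s + 2 * (u * - y + - v * - x))) ^+ 2) == 0 by rewrite eq_le h sqrtr_ge0.
rewrite sqrtr_eq0 sqr_sqrtr ?addr_ge0 ?sqr_ge0// => h.
have /eqP : ((- x + u) ^+ 2 + (- y + v) ^+ 2) ^+ 2 +
  (- (- t + s + 2 * (u * - y + - v * - x))) ^+ 2 == 0.
  by rewrite eq_le h addr_ge0 ?sqr_ge0.
move/eqP; rewrite paddr_eq0 ?sqr_ge0// !sqrf_eq0 paddr_eq0 ?sqr_ge0// !sqrf_eq0.
move=> /andP[/andP[/eqP xu /eqP yv] /eqP ts].
have ux : u = x by lra.
have vy : v = y by lra.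
by move: ts; rewrite ux vy => ts; have -> : s = t by lra.
Qed.

Lemma dK_gt0 (R : realType) (p q : heis R) : p <> q -> 0 < dK p q.
Proof. by move=> pq; rewrite lt_def sqrtr_ge0 andbT; apply/eqP => /dK_eq0. Qed.

Lemma gram_neq0 (R : realType) (p q : heis R) : p <> q -> gram p q != 0.
Proof.
move=> /dK_gt0 pq; apply: contraTneq (pq) => g0.
have := gram_dK p q; rewrite g0 /cabs ComplexField.Normc.normc0 => /esym/eqP.
by rewrite sqrf_eq0 => /eqP ->; rewrite ltxx.
Qed.

Definition cycle4 (R : realType) (p q r s : heis R) : R[i] :=
  gram p q * gram q r * gram r s * gram s p.

(** The Hermitian triple product; the argument of its opposite is Cartan's angular invariant. *)
Definition cycle3 (R : realType) (p q r : heis R) : R[i] :=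
  gram p q * gram q r * gram r p.

(* Vanishing of the 4x4 Gram determinant, expanded. *)
Lemma gram_det4 (R : realType) (p1 p2 p3 p4 : heis R) :
  (cabs (gram p1 p2) * cabs (gram p3 p4)) ^+ 2 +
  (cabs (gram p1 p3) * cabs (gram p2 p4)) ^+ 2 +
  (cabs (gram p1 p4) * cabs (gram p2 p3)) ^+ 2 =
  2 * (complex.Re (cycle4 p1 p2 p3 p4) + complex.Re (cycle4 p1 p3 p2 p4)
       + complex.Re (cycle4 p1 p2 p4 p3)).
Proof.
have n p : hlift0 p + hlift1 p * conjc (hlift1 p) + conjc (hlift0 p) = 0 :> R[i].
  by rewrite -gramE gram_self.
apply: complexI.
have E z w : ((cabs z * cabs w) ^+ 2)%:C = z * conjc z * (w * conjc w) :> R[i].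
  by rewrite exprMn realcM -!mulcJ.
rewrite realcM (rmorph_nat (real_complex R) 2) !realcD !E !conjc_gram.
have := gram4_identity (n p1) (n p2) (n p3) (n p4); rewrite /= -!gramE => ->.
rewrite !mulrDr -!addcJ /cycle4 !conjcM !conjc_gram; ring.
Qed.

(* The Gram determinant of three vectors of C^3 is [- |det|^2], the form having signature (2,1). *)
Lemma Re_cycle3_le0 (R : realType) (p1 p2 p3 : heis R) : complex.Re (cycle3 p1 p2 p3) <= 0.
Proof.
have n p : hlift0 p + hlift1 p * conjc (hlift1 p) + conjc (hlift0 p) = 0 :> R[i].
  by rewrite -gramE gram_self.
have := gram3_identity (n p1) (n p2) (n p3); rewrite -!gramE => h.
set D := hlift0 p1 * (hlift1 p2 - hlift1 p3) + hlift0 p2 * (hlift1 p3 - hlift1 p1)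
  + hlift0 p3 * (hlift1 p1 - hlift1 p2).
have : cycle3 p1 p2 p3 + conjc (cycle3 p1 p2 p3) = - (D * conjc D).
  have -> : conjc D = conjc (hlift0 p1) * (conjc (hlift1 p2) - conjc (hlift1 p3))
      + conjc (hlift0 p2) * (conjc (hlift1 p3) - conjc (hlift1 p1))
      + conjc (hlift0 p3) * (conjc (hlift1 p1) - conjc (hlift1 p2)).
    by rewrite /D !(conjcD, conjcM, conjcN).
  by rewrite -h /cycle3 !conjcM !conjc_gram; ring.
rewrite addcJ mulcJ -(rmorph_nat (real_complex R) 2) -realcM -realcN => /complexI h2.
have := sqr_ge0 (cabs D); lra.
Qed.

Lemma ptolemy_of_squares (F : realFieldType) (x y z : F) : 0 < x -> 0 < y -> 0 < z ->
  (x ^+ 2) ^+ 2 + (y ^+ 2) ^+ 2 + (z ^+ 2) ^+ 2 <=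
    2 * (x ^+ 2 * y ^+ 2 + y ^+ 2 * z ^+ 2 + x ^+ 2 * z ^+ 2) -> x <= y + z.
Proof.
move=> x0 y0 z0 h; rewrite leNgt; apply/negP => lt.
(* Heron's factorization of the left side minus the right side of [h]; all four factors are positive
   when x > y + z. *)
have : 0 < (x + y + z) * (x - y - z) * ((x + y - z) * (x - y + z)).
  by rewrite !mulr_gt0 //; lra.
nra.
Qed.

Lemma cabs_cycle4 (R : realType) (p q r s : heis R) : cabs (cycle4 p q r s) =
  (dK p q * dK r s) ^+ 2 * (dK q r * dK s p) ^+ 2.
Proof. by rewrite /cycle4 !cabsM !gram_dK; ring. Qed.

Lemma ptolemy (R : realType) (p1 p2 p3 p4 : heis R) :
  p1 <> p2 -> p1 <> p3 -> p1 <> p4 -> p2 <> p3 -> p2 <> p4 -> p3 <> p4 ->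
  dK p1 p2 * dK p3 p4 <= dK p1 p3 * dK p2 p4 + dK p1 p4 * dK p2 p3.
Proof.
move=> *; apply: ptolemy_of_squares; rewrite ?mulr_gt0 ?dK_gt0//.
have := gram_det4 p1 p2 p3 p4; rewrite !gram_dK -!exprMn => ->.
have := Re_le_cabs (cycle4 p1 p2 p3 p4); have := Re_le_cabs (cycle4 p1 p3 p2 p4).
have := Re_le_cabs (cycle4 p1 p2 p4 p3).
rewrite !cabs_cycle4 (dKC p4 p1) (dKC p3 p1) (dKC p3 p2) (dKC p4 p3).
lra.
Qed.

Lemma ptolemy_eq_cycle4 (R : realType) (p1 p2 p3 p4 : heis R) :
  dK p1 p2 * dK p3 p4 = dK p1 p3 * dK p2 p4 + dK p1 p4 * dK p2 p3 ->
  [/\ cycle4 p1 p2 p3 p4 = (cabs (cycle4 p1 p2 p3 p4))%:C,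
      cycle4 p1 p3 p2 p4 = (cabs (cycle4 p1 p3 p2 p4))%:C &
      cycle4 p1 p2 p4 p3 = (cabs (cycle4 p1 p2 p4 p3))%:C].
Proof.
move=> e.
have := gram_det4 p1 p2 p3 p4; rewrite !gram_dK -!exprMn.
have := Re_le_cabs (cycle4 p1 p2 p3 p4); have := Re_le_cabs (cycle4 p1 p3 p2 p4).
have := Re_le_cabs (cycle4 p1 p2 p4 p3).
move=> h1 h2 h3 h.
suff : [/\ complex.Re (cycle4 p1 p2 p3 p4) = cabs (cycle4 p1 p2 p3 p4),
   complex.Re (cycle4 p1 p3 p2 p4) = cabs (cycle4 p1 p3 p2 p4) &
   complex.Re (cycle4 p1 p2 p4 p3) = cabs (cycle4 p1 p2 p4 p3)].
  by case=> *; split; exact: Re_eq_cabs.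
(* When x = y + z Heron's polynomial vanishes, so the three bounds of a real part by a modulus add
   up to an equality, and each of them is one. *)
have s : cabs (cycle4 p1 p2 p3 p4) + cabs (cycle4 p1 p3 p2 p4) + cabs (cycle4 p1 p2 p4 p3) =
  complex.Re (cycle4 p1 p2 p3 p4) + complex.Re (cycle4 p1 p3 p2 p4)
  + complex.Re (cycle4 p1 p2 p4 p3).
  move: h; rewrite !cabs_cycle4 (dKC p4 p1) (dKC p3 p1) (dKC p3 p2) (dKC p4 p3) e.
  rewrite (mulrC (dK p2 p3)) (mulrC (dK p2 p4)).
  move: (dK p1 p3 * dK p2 p4) (dK p1 p4 * dK p2 p3) => y z h; lra.
by split; lra.
Qed.

(** * Equality implies concircularity *)

Lemma hlift_neq0 (R : realType) (p : heis R) : hlift p != 0.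
Proof.
apply/eqP => /matrixP /(_ 2%:R 0); rewrite !mxE /= => /eqP.
by rewrite oner_eq0.
Qed.

Lemma on_Rcircle_real (R : realType) (A : 'M[R[i]]_3) (p : heis R) (lam a b c : R[i]) :
  preserves_herm A -> a \is Num.real -> b \is Num.real -> c \is Num.real ->
  hlift p = lam *: (A *m vec3 a b c) -> on_Rcircle A p.
Proof.
move=> pA /RRe_real ea /RRe_real eb /RRe_real ec e.
have lam0 : lam != 0 by apply: contraNneq (hlift_neq0 p) => l0; rewrite e l0 scale0r.
pose r : 'cV[R]_3 := \col_(k < 3) nth 0 [:: complex.Re a; complex.Re b; complex.Re c] k.
have er : vec3 a b c = cplxv r.
  by rewrite cplxvE !mxE /= ea eb ec.
exists r; split.
- apply: contraNneq (hlift_neq0 p) => r0.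
  by rewrite e er r0 /cplxv map_mx0 mulmx0 scaler0.
- have := gram_self p; rewrite /gram e hermZl hermZr pA er => /eqP.
  by rewrite !mulf_eq0 conjc_eq0 !(negbTE lam0) => /eqP.
- by exists lam; [exact: lam0 | rewrite -er].
Qed.

Lemma sqr_pos_real (R : realType) (z : R[i]) (k c : R) :
  0 < k -> 0 < c -> z ^+ 2 * k%:C = c%:C -> complex.Im z = 0.
Proof.
case: z => a b k0 c0 /eqP; rewrite eq_complex /= => /andP[/eqP h1 /eqP h2].
have ab : a * b = 0.
  have : a * b * k = 0 by lra.
  by move/eqP; rewrite mulf_eq0 (gt_eqF k0) orbF => /eqP.
move/eqP: ab; rewrite mulf_eq0 => /orP[]/eqP // a0.
by move: h1; rewrite a0; have := sqr_ge0 b; nra.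
Qed.

Lemma real_cycle3 (R : realType) (p1 p2 p3 p4 : heis R) :
  p1 <> p2 -> p1 <> p3 -> p1 <> p4 -> p2 <> p3 -> p2 <> p4 -> p3 <> p4 ->
  dK p1 p2 * dK p3 p4 = dK p1 p3 * dK p2 p4 + dK p1 p4 * dK p2 p3 ->
  [/\ exists2 h, 0 < h & cycle3 p1 p2 p3 = - h%:C,
      cycle3 p1 p2 p4 \is Num.real & cycle3 p1 p3 p4 \is Num.real].
Proof.
move=> n12 n13 n14 n23 n24 n34 /ptolemy_eq_cycle4[e1 e2 e3].
have pos (p q r s : heis R) : p <> q -> r <> s -> q <> r -> s <> p -> 0 < cabs (cycle4 p q r s).
  by move=> *; rewrite cabs_cycle4 mulr_gt0// exprn_gt0// mulr_gt0// dK_gt0.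
have c1 := pos _ _ _ _ n12 n34 n23 (nesym n14).
have c2 := pos _ _ _ _ n13 n24 (nesym n23) (nesym n14).
have c3 := pos _ _ _ _ n12 (nesym n34) n24 (nesym n13).
have x_gt0 (p q : heis R) : p <> q -> 0 < cabs (gram p q).
  by move=> pq; rewrite gram_dK exprn_gt0// dK_gt0.
have H0 : cycle3 p1 p2 p3 != 0.
  by rewrite /cycle3 !mulf_neq0// gram_neq0//; exact: nesym.
have HIm : complex.Im (cycle3 p1 p2 p3) = 0.
  (* [cycle3 ^+ 2] is a positive multiple of the product of the first, the conjugate of the
     second and the third of the positive numbers [cycle4]. *)
  apply: (@sqr_pos_real _ _
     (cabs (gram p3 p4) ^+ 2 * cabs (gram p1 p4) ^+ 2 * cabs (gram p2 p4) ^+ 2)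
     (cabs (cycle4 p1 p2 p3 p4) * cabs (cycle4 p1 p3 p2 p4)
      * cabs (cycle4 p1 p2 p4 p3))).
  - by rewrite !mulr_gt0// x_gt0.
  - by rewrite !mulr_gt0.
  - have M3 (x y z : R) : (x * y * z)%:C = x%:C * y%:C * z%:C by rewrite !realcM.
    rewrite !M3 -e1 -e3 -[(cabs (cycle4 p1 p3 p2 p4))%:C]conjc_real -e2 -!mulcJ !conjc_gram.
    by rewrite /cycle4 /cycle3 !conjcM !conjc_gram; ring.
have HE : cycle3 p1 p2 p3 = - (- complex.Re (cycle3 p1 p2 p3))%:C.
  by rewrite realcN opprK [LHS]complexE HIm mulr0 addr0.
have Hreal : conjc (cycle3 p1 p2 p3) \is Num.real.
  by rewrite HE conjcN conjc_real rpredN complex_real.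
have real_mul (u v w : R[i]) : u != 0 -> u \is Num.real -> w \is Num.real -> u * v = w ->
    v \is Num.real.
  by move=> u0 ur wr e; rewrite -[v](mulKf u0) e rpredM// rpredV.
have realC (x : R) : x%:C \is Num.real by rewrite complex_real.
split.
- exists (- complex.Re (cycle3 p1 p2 p3)) => //.
  rewrite oppr_gt0 lt_def Re_cycle3_le0 andbT eq_sym.
  by apply: contraNneq H0 => re0; rewrite HE re0 oppr0 oppr0.
(* Two triple products running through a common edge in opposite directions multiply to a four-cycle
   times the squared modulus of that edge. Here the edge is [p1], [p2]; in the next case it is [p1],
   [p3]. *)
- apply: (real_mul (conjc (cycle3 p1 p2 p3)) _
    (cycle4 p1 p3 p2 p4 * (gram p1 p2 * conjc (gram p1 p2)))) => //.
  + by rewrite conjc_eq0.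
  + by rewrite e2 mulcJ rpredM.
  + by rewrite /cycle4 /cycle3 !conjcM !conjc_gram; ring.
- apply: (real_mul (cycle3 p1 p2 p3) _
    (cycle4 p1 p2 p3 p4 * (gram p1 p3 * conjc (gram p1 p3)))) => //.
  + by rewrite -[cycle3 _ _ _]conjcK; move: Hreal; rewrite HE conjcN conjc_real -realcN conjc_real.
  + by rewrite e1 mulcJ rpredM.
  + by rewrite /cycle4 /cycle3 conjc_gram; ring.
Qed.

Lemma equality_Rcircle (R : realType) (p1 p2 p3 p4 : heis R) :
  p1 <> p2 -> p1 <> p3 -> p1 <> p4 -> p2 <> p3 -> p2 <> p4 -> p3 <> p4 ->
  dK p1 p2 * dK p3 p4 = dK p1 p3 * dK p2 p4 + dK p1 p4 * dK p2 p3 ->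
  exists2 A : 'M[R[i]]_3, preserves_herm A &
    [/\ on_Rcircle A p1, on_Rcircle A p2, on_Rcircle A p3 & on_Rcircle A p4].
Proof.
move=> n12 n13 n14 n23 n24 n34 /(real_cycle3 n12 n13 n14 n23 n24 n34)[[h h0 hE] r124 r134].
pose v p := @hlift R p.
have g12 := gram_neq0 n12; have g13 := gram_neq0 n13; have g14 := gram_neq0 n14.
have g21 := gram_neq0 (nesym n12); have g31 := gram_neq0 (nesym n13).
have g41 := gram_neq0 (nesym n14).
have x_gt0 (p q : heis R) : p <> q -> 0 < cabs (gram p q).
  by move=> pq; rewrite gram_dK exprn_gt0// dK_gt0.
(* The scalings of [u2] and [u3] below make their products with [u1] equal to -1 for any real
   nonzero [rc]. The product of [u2] with [u3] is -1 only if [rc ^+ 2] equals [k], which has a real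
   square root because the triple product is negative. *)
pose k := h / (cabs (gram p1 p2) ^+ 2 * cabs (gram p1 p3) ^+ 2).
have k0 : 0 < k by rewrite divr_gt0// mulr_gt0// exprn_gt0// x_gt0.
pose rc : R[i] := (Num.sqrt k)%:C.
have rc0 : rc != 0.
  by rewrite eq_complex /= negb_and gt_eqF ?sqrtr_gt0.
have rcJ : conjc rc = rc by exact: conjc_real.
have rcr : rc \is Num.real by rewrite complex_real.
have rc2 : rc ^+ 2 * (gram p1 p2 * gram p2 p1 * (gram p1 p3 * gram p3 p1)) = h%:C.
  rewrite -(conjc_gram p1 p2) -(conjc_gram p1 p3) !mulcJ expr2 -!realcM -expr2 sqr_sqrtr ?ltW//.
  congr (_%:C); rewrite /k mulfVK// gt_eqF// mulr_gt0// exprn_gt0// x_gt0//.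
have g23 : gram p2 p3 = - rc ^+ 2 * gram p2 p1 * gram p1 p3.
  apply: (mulfI (mulf_neq0 g12 g31)).
  move: hE; rewrite /cycle3 -rc2 => hE.
  transitivity (gram p1 p2 * gram p2 p3 * gram p3 p1); first by ring.
  by rewrite hE; ring.
(* The lifts [u1], [u2], [u3] have all mutual products [-1], like the real null vectors (-1,0,0),
   (0,0,1), (-1,sqrt 2,1), which the frame [U0], [U1], [u2] carries to them. *)
have [u1 E1] : exists u, u = rc *: v p1 by eexists.
have [u2 E2] : exists u, u = - (rc * gram p2 p1)^-1 *: v p2 by eexists.
have [u3 E3] : exists u, u = - (rc * gram p3 p1)^-1 *: v p3 by eexists.
have hv p q : herm (v p) (v q) = gram p q by [].
have h11 : herm u1 u1 = 0 by rewrite E1 hermZl hermZr hv gram_self !mulr0.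
have h22 : herm u2 u2 = 0 by rewrite E2 hermZl hermZr hv gram_self !mulr0.
have h33 : herm u3 u3 = 0 by rewrite E3 hermZl hermZr hv gram_self !mulr0.
have h12 : herm u1 u2 = - 1.
  rewrite E1 E2 hermZl hermZr hv conjcN conjc_inv conjcM conjc_gram rcJ; field.
  by rewrite rc0 g12.
have h13 : herm u1 u3 = - 1.
  rewrite E1 E3 hermZl hermZr hv conjcN conjc_inv conjcM conjc_gram rcJ; field.
  by rewrite rc0 g13.
have h23 : herm u2 u3 = - 1.
  rewrite E2 E3 hermZl hermZr hv conjcN conjc_inv conjcM conjc_gram rcJ g23; field.
  by rewrite rc0 g13 g21.
have h21 : herm u2 u1 = - 1 by rewrite -conjc_herm h12 conjcN conjc1.
have h31 : herm u3 u1 = - 1 by rewrite -conjc_herm h13 conjcN conjc1.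
have h32 : herm u3 u2 = - 1 by rewrite -conjc_herm h23 conjcN conjc1.
pose s2 : R[i] := (Num.sqrt 2)%:C.
have s2s : s2 * s2 = 2.
  by rewrite /s2 -realcM -expr2 sqr_sqrtr// (rmorph_nat (real_complex R) 2).
have s20 : s2 != 0.
  by apply/eqP => s0; move/eqP: s2s; rewrite s0 mul0r eq_sym pnatr_eq0.
have s2J : conjc s2 = s2 by exact: conjc_real.
have s2r : s2 \is Num.real by rewrite complex_real.
pose U0 := (- 1) *: u1; pose U1 := s2^-1 *: (u3 + ((- 1) *: u1 + (- 1) *: u2)).
have cN1 : conjc (- 1) = - 1 :> R[i] by rewrite conjcN conjc1.
have H00 : herm U0 U0 = 0 by rewrite hermZl hermZr h11 !mulr0.
have H01 : herm U0 U1 = 0.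
  by rewrite !(hermZl, hermZr, hermDr) h11 h12 h13 cN1; ring.
have H02 : herm U0 u2 = 1 by rewrite hermZl h12; ring.
have H11 : herm U1 U1 = 1.
  rewrite !(hermZl, hermZr, hermDr, hermDl) h11 h12 h13 h21 h22 h23 h31 h32 h33 cN1.
  by rewrite conjc_inv s2J; field: s2s.
have H12 : herm U1 u2 = 0.
  by rewrite !(hermZl, hermDl) h12 h22 h32; ring.
have pA := frame_preserves_herm H00 H01 H02 H11 H12 h22.
have coord w := frame_coord w H00 H01 H02 H11 H12 h22.
exists (frame U0 U1 u2) => //.
(* The coordinates in the frame are products with [u2], [U1] and [U0], which are real combinations
   of products with [u1], [u2], [u3]. *)
have real_lift p lam : lam != 0 -> herm (lam *: v p) u1 \is Num.real ->
    herm (lam *: v p) u2 \is Num.real -> herm (lam *: v p) u3 \is Num.real ->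
    on_Rcircle (frame U0 U1 u2) p.
  move=> lam0 R1 R2 R3.
  apply: (@on_Rcircle_real _ _ _ lam^-1 _ (herm (lam *: v p) U1)
    (herm (lam *: v p) U0) pA R2); last by rewrite coord scalerA mulVf// scale1r.
  - rewrite /U1 !(hermZr, hermDr) cN1 conjc_inv s2J.
    by rewrite rpredM ?rpredV// rpredD// rpredD// rpredM// rpredN rpred1.
  - by rewrite /U0 hermZr cN1 rpredM// rpredN rpred1.
split.
- apply: (real_lift _ rc) => //; rewrite -E1 ?h11 ?h12 ?h13 ?rpredN ?rpred0 ?rpred1//.
- apply: (real_lift _ (- (rc * gram p2 p1)^-1));
    rewrite -?E2 ?h21 ?h22 ?h23 ?rpredN ?rpred0 ?rpred1//.
  by rewrite oppr_eq0 invr_eq0 mulf_neq0.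
- apply: (real_lift _ (- (rc * gram p3 p1)^-1));
    rewrite -?E3 ?h31 ?h32 ?h33 ?rpredN ?rpred0 ?rpred1//.
  by rewrite oppr_eq0 invr_eq0 mulf_neq0.
- have realJ (z : R[i]) : (conjc z \is Num.real) = (z \is Num.real).
    by case: z => a b; rewrite /= !complex_real oppr_eq0.
  have realg (p q : heis R) : gram p q * gram q p \is Num.real.
    by rewrite -(conjc_gram p q) mulcJ complex_real.
  (* This scaling makes the product with [u1] equal to [rc]; the products with [u2] and [u3] become
     real multiples of conjugates of the real triple products through [p4]. *)
  apply: (real_lift _ (gram p4 p1)^-1); rewrite ?invr_eq0//.
  + by rewrite E1 hermZl hermZr hv rcJ mulrCA mulVf// mulr1.
  + rewrite E2 hermZl hermZr hv conjcN conjc_inv conjcM conjc_gram rcJ.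
    have -> : (gram p4 p1)^-1 * (- (rc * gram p1 p2)^-1 * gram p4 p2) =
      - (rc * (gram p1 p2 * gram p2 p1) * (gram p1 p4 * gram p4 p1))^-1 * conjc (cycle3 p1 p2 p4).
      by rewrite /cycle3 !conjcM !conjc_gram; field; rewrite rc0 g12 g21 g14 g41.
    by rewrite rpredM ?realJ// rpredN rpredV rpredM// rpredM.
  + rewrite E3 hermZl hermZr hv conjcN conjc_inv conjcM conjc_gram rcJ.
    have -> : (gram p4 p1)^-1 * (- (rc * gram p1 p3)^-1 * gram p4 p3) =
      - (rc * (gram p1 p3 * gram p3 p1) * (gram p1 p4 * gram p4 p1))^-1 * conjc (cycle3 p1 p3 p4).
      by rewrite /cycle3 !conjcM !conjc_gram; field; rewrite rc0 g13 g31 g14 g41.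
    by rewrite rpredM ?realJ// rpredN rpredV rpredM// rpredM.
Qed.

(** * Points of an R-circle *)

Definition at_param (R : realType) (A : 'M[R[i]]_3) (p : heis R) (w : R * R) : Prop :=
  proj_eq (hlift p) (A *m cplxv (stdR w)).

Lemma herm_stdR (R : realType) (w w' : R * R) : herm (cplxv (stdR w)) (cplxv (stdR w')) =
  (2 * (w.1 * w'.1 + w.2 * w'.2 - 1))%:C.
Proof.
have s2 : Num.sqrt 2 ^+ 2 = 2 :> R by rewrite sqr_sqrtr.
by rewrite herm_cplxv !mxE /=; congr (_%:C); ring: s2.
Qed.

Lemma stdR_on_Rcircle (R : realType) (A : 'M[R[i]]_3) (p : heis R) (w : R * R) :
  S1 w -> at_param A p w -> on_Rcircle A p.
Proof.
rewrite /S1 /= => Sw pw; exists (stdR w); split=> //.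
- apply/eqP => /matrixP h; have := h 0 0; have := h 2%:R 0; rewrite !mxE /=; lra.
- by rewrite herm_stdR -!expr2 Sw subrr mulr0.
Qed.

Lemma on_Rcircle_stdR (R : realType) (A : 'M[R[i]]_3) (p : heis R) :
  on_Rcircle A p -> exists2 x, S1 x & at_param A p (double_angle x).
Proof.
case=> r [r0 rnull [lam lam0 e]].
move: rnull; rewrite herm_cplxv => /complexI.
pose a := r 0 0; pose b := r 1 0; pose c := r 2%:R 0.
rewrite -/a -/b -/c => rnull.
have s0 : c - a != 0.
  (* If c = a, nullity reads 2a^2 + b^2 = 0 and the vector is zero. *)
  apply: contraNneq r0 => ca; have {}ca : c = a by lra.
  have a2 : a ^+ 2 = 0 by move: rnull; rewrite ca; have := sqr_ge0 a; have := sqr_ge0 b; nra.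
  have a0 : a = 0 by apply/eqP; rewrite -sqrf_eq0 a2.
  have b0 : b = 0 by apply/eqP; rewrite -sqrf_eq0; apply/eqP; move: rnull; rewrite a0; lra.
  apply/eqP/matrixP => k j; rewrite (ord1 j) mxE.
  case: k => [[|[|[|//]]]] lt.
  - by rewrite -[RHS]a0; congr (r _ _); exact/val_inj.
  - by rewrite -[RHS]b0; congr (r _ _); exact/val_inj.
  - by rewrite -[RHS]a0 -ca; congr (r _ _); exact/val_inj.
have s2 : Num.sqrt 2 * Num.sqrt 2 = 2 :> R by rewrite -expr2 sqr_sqrtr.
(* The outer coordinates of [stdR w] have difference 2 and sum 2 [w.1]; rescaling to c - a = 2 lets
   [w] be read off. *)
pose w := ((c + a) / (c - a), Num.sqrt 2 * b / (c - a)).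
have Sw : S1 w.
  rewrite /S1 /= !expr_div_n -mulrDl exprMn expr2 (_ : Num.sqrt 2 ^+ 2 = 2) ?expr2//.
  apply: (mulIf (mulf_neq0 s0 s0)); rewrite mulfVK ?mulf_neq0// mul1r.
  by move: rnull; lra.
have [x Sx wx] := half_angle Sw; exists x => //; rewrite -wx.
have sc : ((c - a) / 2)%:C != 0 :> R[i].
  by rewrite eq_complex /= negb_and mulf_neq0// invr_neq0.
exists (lam * ((c - a) / 2)%:C); first by rewrite mulf_neq0.
rewrite e -scalerA; congr (_ *: _); rewrite scalemxAr; congr (_ *m _).
apply/matrixP => k j; rewrite (ord1 j) !mxE -realcM; congr (_%:C).
case: k => [[|[|[|//]]]] lt /=.
- transitivity a; first by congr (r _ _); exact/val_inj.
  by field.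
- transitivity b; first by congr (r _ _); exact/val_inj.
  transitivity (Num.sqrt 2 * Num.sqrt 2 / 2 * b); first by rewrite s2; field.
  by field.
- transitivity c; first by congr (r _ _); exact/val_inj.
  by field.
Qed.

(** * Distances and Ptolemy's equality on an R-circle *)

Lemma herm_double_angle (R : realType) (x y : R * R) : S1 x -> S1 y ->
  herm (cplxv (stdR (double_angle x))) (cplxv (stdR (double_angle y))) =
  (- (2 * det2 x y) ^+ 2)%:C.
Proof.
move=> Sx Sy; rewrite herm_stdR !double_angleE//=; congr (_%:C).
rewrite /S1 /= in Sx Sy.
(* The constant 1 becomes the product of the squared norms of [x] and [y], leaving a homogeneous
   polynomial identity. *)
rewrite -[X in _ - X]mulr1 -[X in _ - X * _]Sx -[X in _ - _ * X]Sy.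
by rewrite /det2; ring.
Qed.

Lemma dK_double_angle (R : realType) (A : 'M[R[i]]_3) (p q : heis R) (l m : R[i])
    (x y : R * R) : preserves_herm A -> S1 x -> S1 y ->
  hlift p = l *: (A *m cplxv (stdR (double_angle x))) ->
  hlift q = m *: (A *m cplxv (stdR (double_angle y))) ->
  dK p q = Num.sqrt (2 * cabs l) * Num.sqrt (2 * cabs m) * `|det2 x y|.
Proof.
move=> pA Sx Sy ep eq.
have cabs_ge0 (z : R[i]) : 0 <= cabs z by case: z => a b; exact: sqrtr_ge0.
have cabs_real (a : R) : cabs a%:C = `|a|.
  by rewrite /cabs /= expr0n addr0 sqrtr_sqr.
have := gram_dK p q.
rewrite /gram ep eq hermZl hermZr pA herm_double_angle// !cabsM cabsJ cabs_real normrN.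
rewrite normrX normrM ger0_norm// => h.
apply/eqP; rewrite -(eqrXn2 (_ : 0 < 2)%N) ?sqrtr_ge0 ?mulr_ge0 ?sqrtr_ge0//.
rewrite -h !exprMn !sqr_sqrtr ?mulr_ge0//; apply/eqP; ring.
Qed.

(** The factor attached to each point occurs exactly once in each of the three products of
    distances, so it cancels and the planar statement remains. *)
Lemma ptolemy_double_angle (R : realType) (A : 'M[R[i]]_3) (pa pb pc pd : heis R)
    (a b c d : R * R) : preserves_herm A -> S1 a -> S1 b -> S1 c -> S1 d ->
  at_param A pa (double_angle a) -> at_param A pb (double_angle b) ->
  at_param A pc (double_angle c) -> at_param A pd (double_angle d) ->
  dK pa pb * dK pc pd = dK pa pc * dK pb pd + dK pa pd * dK pb pc <->
  det2 a c * det2 b c * (det2 a d * det2 b d) <= 0.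
Proof.
move=> pA Sa Sb Sc Sd [ka ka0 ea] [kb kb0 eb] [kc kc0 ec] [kd kd0 ed].
rewrite -ptolemy_plane.
have D p q l m x y := @dK_double_angle R A p q l m x y pA.
rewrite (D pa pb _ _ a b Sa Sb ea eb) (D pc pd _ _ c d Sc Sd ec ed)
  (D pa pc _ _ a c Sa Sc ea ec) (D pb pd _ _ b d Sb Sd eb ed)
  (D pa pd _ _ a d Sa Sd ea ed) (D pb pc _ _ b c Sb Sc eb ec).
have mu (k : R[i]) : k != 0 -> Num.sqrt (2 * cabs k) != 0.
  move=> k0; rewrite sqrtr_eq0 -ltNge mulr_gt0// lt_def.
  case: k k0 => x y k0; rewrite sqrtr_ge0 andbT.
  by apply: contraNneq k0 => /ComplexField.Normc.eq0_normc ->.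
move: (mu _ ka0) (mu _ kb0) (mu _ kc0) (mu _ kd0).
move: (Num.sqrt (2 * cabs ka)) (Num.sqrt (2 * cabs kb))
  (Num.sqrt (2 * cabs kc)) (Num.sqrt (2 * cabs kd)).
move=> ma mb mc md ma0 mb0 mc0 md0.
split=> [h|h].
  apply: (mulfI (mulf_neq0 (mulf_neq0 ma0 mb0) (mulf_neq0 mc0 md0))).
  by move: h; lra.
by transitivity (ma * mb * (mc * md) * (`|det2 a b| * `|det2 c d|)); [ring | rewrite h; ring].
Qed.

Lemma ptolemy_eq_separates (R : realType) (pa pb pc pd : heis R) :
  pa <> pb -> pa <> pc -> pa <> pd -> pb <> pc -> pb <> pd -> pc <> pd ->
  dK pa pb * dK pc pd = dK pa pc * dK pb pd + dK pa pd * dK pb pc <->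
  exists2 A, preserves_herm A & separates A pa pb pc pd.
Proof.
move=> nab nac nad nbc nbd ncd; split=> [e|[A pA]].
  have [A pA [Ra Rb Rc Rd]] := equality_Rcircle nab nac nad nbc nbd ncd e.
  have [a Sa ea] := on_Rcircle_stdR Ra; have [b Sb eb] := on_Rcircle_stdR Rb.
  have [c Sc ec] := on_Rcircle_stdR Rc; have [d Sd ed] := on_Rcircle_stdR Rd.
  (* Distinct points have nonzero determinants, which makes the sign condition strict, as separation
     requires. *)
  have dN0 p q x y : p <> q -> S1 x -> S1 y -> at_param A p (double_angle x) ->
      at_param A q (double_angle y) -> det2 x y != 0.
    move=> pq Sx Sy [l _ ep] [m _ eq]; apply: contraTneq (dK_gt0 pq) => xy0.
    by rewrite (dK_double_angle pA Sx Sy ep eq) xy0 normr0 mulr0 ltxx.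
  have nac0 := dN0 _ _ _ _ nac Sa Sc ea ec; have nad0 := dN0 _ _ _ _ nad Sa Sd ea ed.
  have nbc0 := dN0 _ _ _ _ nbc Sb Sc eb ec; have nbd0 := dN0 _ _ _ _ nbd Sb Sd eb ed.
  have circ x : S1 x -> S1 (double_angle x) by move=> Sx; exact/double_angle_S1/S1_neq0.
  have off x : S1 x -> det2 a x != 0 -> det2 b x != 0 ->
      (@S1 R `\` [set double_angle a; double_angle b]) (double_angle x).
    move=> Sx ax bx; split; first exact: circ.
    by case=> /esym h; [move: ax | move: bx]; apply/negP; rewrite negbK; apply/eqP;
      apply/double_angle_eq; rewrite ?S1_neq0.
  exists A => //; exists (double_angle a), (double_angle b), (double_angle c), (double_angle d).
  split.
  - by split; [exact: circ Sa | exact: circ Sb | exact: circ Sc | exact: circ Sd].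
  - by split; [exact: ea | exact: eb | exact: ec | exact: ed].
  - exact: off Sc nac0 nbc0.
  - exact: off Sd nad0 nbd0.
  apply: opposite_sides_separate => //.
  rewrite lt_neqAle !mulf_neq0//=.
  exact/(ptolemy_double_angle pA Sa Sb Sc Sd ea eb ec ed).
case=> wa [wb [wc [wd [[Sa Sb Sc Sd] [ea eb ec ed] _ _ sep]]]].
have [a Ta wE] := half_angle Sa; rewrite wE in ea sep.
have [b Tb wE'] := half_angle Sb; rewrite wE' in eb sep.
have [c Tc wE2] := half_angle Sc; rewrite wE2 in ec sep.
have [d Td wE3] := half_angle Sd; rewrite wE3 in ed sep.
apply/(ptolemy_double_angle pA Ta Tb Tc Td ea eb ec ed).
(* A positive sign would put the last two points in one component. *)
by rewrite leNgt; apply/negP => h; exact/sep/same_side_connected.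
Qed.

Lemma separates_on_Rcircle (R : realType) (A : 'M[R[i]]_3) (pa pb pc pd : heis R) :
  separates A pa pb pc pd ->
  [/\ on_Rcircle A pa, on_Rcircle A pb, on_Rcircle A pc & on_Rcircle A pd].
Proof.
case=> wa [wb [wc [wd [[Sa Sb Sc Sd] [ea eb ec ed] _ _ _]]]].
by split; [exact: stdR_on_Rcircle ea | exact: stdR_on_Rcircle eb
  | exact: stdR_on_Rcircle ec | exact: stdR_on_Rcircle ed].
Qed.

(* The three cases by relabelling the points *)
Local Close Scope complex_scope.
Local Close Scope classical_set_scope.
Unset Implicit Arguments.

Theorem theorem3p2 (R : realType) (p1 p2 p3 p4 : heis R) :
  p1 <> p2 -> p1 <> p3 -> p1 <> p4 -> p2 <> p3 -> p2 <> p4 -> p3 <> p4 ->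
  [/\ [/\ dK p2 p3 * dK p1 p4 <= dK p2 p4 * dK p1 p3 + dK p1 p2 * dK p3 p4,
          dK p1 p3 * dK p2 p4 <= dK p1 p2 * dK p3 p4 + dK p2 p3 * dK p1 p4 &
          dK p1 p2 * dK p3 p4 <= dK p1 p3 * dK p2 p4 + dK p2 p3 * dK p1 p4],
      (dK p2 p3 * dK p1 p4 = dK p2 p4 * dK p1 p3 + dK p1 p2 * dK p3 p4 <->
         Rcircle_sep p1 p2 p3 p4 p1 p4 p2 p3),
      (dK p1 p3 * dK p2 p4 = dK p1 p2 * dK p3 p4 + dK p2 p3 * dK p1 p4 <->
         Rcircle_sep p1 p2 p3 p4 p1 p3 p2 p4) &
      (dK p1 p2 * dK p3 p4 = dK p1 p3 * dK p2 p4 + dK p2 p3 * dK p1 p4 <->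
         Rcircle_sep p1 p2 p3 p4 p1 p2 p3 p4)].
Proof.
move=> n12 n13 n14 n23 n24 n34.
have n32 := nesym n23; have n42 := nesym n24; have n43 := nesym n34.
(* Each case lists first the pairs whose product stands alone on the left: 14 and 23, then 13 and
   24, then 12 and 34. *)
have I1 := ptolemy n14 n12 n13 n42 n43 n23.
have I2 := ptolemy n13 n12 n14 n32 n34 n24.
have I3 := ptolemy n12 n13 n14 n23 n24 n34.
have E1 := ptolemy_eq_separates n14 n12 n13 n42 n43 n23.
have E2 := ptolemy_eq_separates n13 n12 n14 n32 n34 n24.
have E3 := ptolemy_eq_separates n12 n13 n14 n23 n24 n34.
move: I1 I2 I3 E1 E2 E3.
rewrite (dKC p4 p2) (dKC p4 p3) (dKC p3 p2) => I1 I2 I3 E1 E2 E3.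
split; [split; lra | | | ].
- split=> [e|[A [pA _ s]]].
    have [|A pA s] := E1.1; first lra.
    by exists A; split=> //; case: (separates_on_Rcircle s).
  have := E1.2 (ex_intro2 _ _ A pA s); lra.
- split=> [e|[A [pA _ s]]].
    have [|A pA s] := E2.1; first lra.
    by exists A; split=> //; case: (separates_on_Rcircle s).
  have := E2.2 (ex_intro2 _ _ A pA s); lra.
- split=> [e|[A [pA _ s]]].
    have [|A pA s] := E3.1; first lra.
    by exists A; split=> //; case: (separates_on_Rcircle s).
  have := E3.2 (ex_intro2 _ _ A pA s); lra.
Qed.
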